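(* Let $G$ be a graph on $n$ vertices with Lanzhou eigenvalues $\lambda_1\geq\cdots\geq\lambda_n$, and let $\|A_{Lz}(G)\|_F$ denote the Frobenius norm of $A_{Lz}(G)$. Then $$S(A_{Lz}(G))\leq \lambda_1+\sqrt{\|A_{Lz}(G)\|_F^2-\lambda_1^2}.$$ Equality holds if and only if $\lambda_i=0$ for all $2\leq i\leq n-1$ and $\lambda_1=-\lambda_n$.
   Context: Graphs are finite, simple and undirected. For a graph $G$ on $n$ vertices, $d_G(u)$ is the degree of $u$ in $G$ and $d_{\overline{G}}(u)=n-1-d_G(u)$ is its degree in the complement $\overline{G}$. The Lanzhou matrix $A_{Lz}(G)$ is the real symmetric $n\times n$ matrix indexed by vertices whose $(u,v)$ entry is $d_G(u)d_{\overline{G}}(u)+d_G(v)d_{\overline{G}}(v)$ if $u$ and $v$ are adjacent in $G$, and $0$ otherwise. Its eigenvalues $\lambda_1\geq\cdots\geq\lambda_n$ are the Lanzhou eigenvalues of $G$. The spread is $S(A_{Lz}(G))=\lambda_1-\lambda_n$. The Frobenius norm is the square root of the sum of the squares of all entries. *)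

(* Defs.v *)
From HB Require Import structures.
From mathcomp Require Import all_boot all_order all_algebra.
From mathcomp Require Import polyrcf.

Set Implicit Arguments.
Unset Strict Implicit.
Unset Printing Implicit Defensive.

Import Order.TTheory GRing.Theory Num.Theory.
Local Open Scope ring_scope.

Definition deg (V : finType) (e : rel V) (u : V) : nat := #|[set v | e u v]|.

Definition compl_rel (V : finType) (e : rel V) : rel V :=
  [rel u v | (u != v) && ~~ e u v].

Lemma deg_compl (V : finType) (e : rel V) (u : V) :
  irreflexive e -> deg (compl_rel e) u = (#|V| - 1 - deg e u)%N.
Proof.
move=> eirr; rewrite /deg -subnDA.
have -> : [set v | compl_rel e u v] = ~: (u |: [set v | e u v]).
  by apply/setP => v; rewrite !inE negb_or eq_sym.
by rewrite cardsCs setCK cardsU1 inE eirr.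
Qed.

Definition lanzhou_weight (V : finType) (e : rel V) (u : V) : nat :=
  (deg e u * deg (compl_rel e) u)%N.

(* Row and column i correspond to the vertex enum_val i; enum_val is a
   bijection from 'I_#|V| to V. *)
Definition lanzhou_mx (R : rcfType) (V : finType) (e : rel V) : 'M[R]_#|V| :=
  \matrix_(i, j)
    if e (enum_val i) (enum_val j)
    then (lanzhou_weight e (enum_val i) + lanzhou_weight e (enum_val j))%:R
    else 0.

(* The roots in R of the characteristic polynomial of A, repeated according
   to multiplicity, in nonincreasing order.  When A is symmetric the
   characteristic polynomial splits over R, so this list has length n. *)
Definition spectrum (R : rcfType) (n : nat) (A : 'M[R]_n) : seq R :=
  let p := char_poly A in
  sort >=%R (flatten [seq nseq (mup x p) x | x <- rootsR p]).

(* Counted from 1: eigval A 1 is the largest eigenvalue and, for symmetric A,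
   eigval A n is the smallest one. *)
Definition eigval (R : rcfType) (n : nat) (A : 'M[R]_n) (i : nat) : R :=
  nth 0 (spectrum A) i.-1.

Definition spread (R : rcfType) (n : nat) (A : 'M[R]_n) : R :=
  eigval A 1 - eigval A n.

Definition frobenius_norm (R : rcfType) (m n : nat) (A : 'M[R]_(m, n)) : R :=
  Num.sqrt (\sum_i \sum_j A i j ^+ 2).

(* Main.v *)
Require Import Defs.
From mathcomp Require Import all_boot all_order all_algebra.
From mathcomp Require Import complex polyrcf lra.
Import Order.TTheory GRing.Theory Num.Theory.
Local Open Scope ring_scope.

(** The matrix is symmetric with zero diagonal, so it is orthogonally
    diagonalizable over the real closed field: its eigenvalues sum to 0 and
    their squares sum to the squared Frobenius norm.  Dropping the middle
    eigenvalues gives lambda_n^2 <= |A|_F^2 - lambda_1^2.  Equality forces the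
    middle eigenvalues to vanish, and then the trace gives
    lambda_1 = - lambda_n. *)

(** The scalar matrix of ['X] is fixed by conjugation, so ['X - A] is conjugated as a whole, and the
    determinants of [P] and its inverse cancel. *)
Lemma char_poly_conj (F : fieldType) (n : nat) (P A : 'M[F]_n) :
  P \in unitmx -> char_poly (invmx P *m A *m P) = char_poly A.
Proof.
move=> Pu; rewrite /char_poly /char_poly_mx !map_mxM /=.
set Q := map_mx _ (invmx P); set S := map_mx _ P.
have QS : Q *m S = 1%:M by rewrite -map_mxM mulVmx // map_mx1.
have XE : 'X%:M = Q *m 'X%:M *m S :> 'M_n.
  by rewrite scalar_mxC -mulmxA QS mulmx1.
rewrite {1}XE -mulmxBl -mulmxBr !det_mulmx mulrAC -det_mulmx QS.
by rewrite det1 mul1r.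
Qed.

(* The diagonalization is carried out over R[i]; A is hermitian there, so the
   eigenvalues lie in R. *)
Lemma sym_spectral (R : rcfType) (n : nat) (A : 'M[R]_n) :
  A^T = A ->
  exists d : 'rV[R]_n, [/\ char_poly A = \prod_i ('X - (d 0 i)%:P),
    \tr A = \sum_i d 0 i & \tr (A *m A) = \sum_i d 0 i ^+ 2].
Proof.
move=> Asym; pose f : {rmorphism R -> R[i]%C} := real_complex R; pose B := map_mx f A.
have Bherm : B \is hermsymmx.
  apply: realsym_hermsym.
    by apply/is_hermitianmxP; rewrite expr0 scale1r map_mx_id // map_trmx Asym.
  by apply/mxOverP => i j; rewrite mxE; apply/complex_realP; exists (A i j).
have /orthomx_spectralP := hermitian_normalmx Bherm.
have Pu := spectral_unit B.
move: (spectralmx B) (spectral_diag B) Pu (hermitian_spectral_diag_real Bherm).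
move=> P D Pu /mxOverP Dreal BE; pose d := map_mx (@complex.Re R) D.
(* The diagonal entries are real, so taking real parts loses nothing; each claim can then be checked
   in [R[i]] and pulled back along the injective [f]. *)
have DE : D = map_mx f d.
  by apply/rowP => i; rewrite !mxE; apply/esym/RRe_real/Dreal.
exists d; split.
- apply: (map_inj_poly (fmorph_inj f)); first exact: rmorph0.
  rewrite map_char_poly -/B BE char_poly_conj // char_poly_trig ?diag_mx_is_trig //.
  rewrite rmorph_prod; apply: eq_bigr => i _.
  by rewrite /= map_polyXsubC DE !mxE eqxx mulr1n.
- apply: (fmorph_inj f); rewrite -trace_map_mx -/B BE mxtrace_mulC mulmxA.
  rewrite mulmxV // mul1mx mxtrace_diag rmorph_sum.
  by apply: eq_bigr => i _; rewrite DE !mxE.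
apply: (fmorph_inj f); rewrite -trace_map_mx map_mxM -/B BE.
rewrite !mulmxA mulmxK // -mulmxA mxtrace_mulC mulmxA -mulmxA.
rewrite -mulmxA mulKVmx // mulmx_diag mxtrace_diag rmorph_sum.
by apply: eq_bigr => i _; rewrite DE !mxE rmorphXn.
Qed.

(** Both lists contain each [x] as often as its multiplicity as a root of the characteristic
    polynomial. *)
Lemma perm_spectrum (R : rcfType) (n : nat) (A : 'M[R]_n) (s : seq R) :
  char_poly A = \prod_(x <- s) ('X - x%:P) -> perm_eq (spectrum A) s.
Proof.
move=> pE; rewrite /spectrum perm_sort.
have p0 : char_poly A != 0 by rewrite monic_neq0 ?char_poly_monic.
move: p0 pE; set p := char_poly A => p0 pE.
apply/allP => x _ /=; apply/eqP.
have -> : count_mem x s = mup x p by rewrite pE mu_prod_XsubC.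
rewrite count_flatten -map_comp sumnE big_map.
under eq_bigr => y _ do rewrite /= count_nseq /=.
(* A root occurs once in [rootsR p], so only its own block contributes; for a non-root both counts
   are 0. *)
have [rx|nrx] := boolP (x \in rootsR p); last first.
  rewrite big_seq big1 => [|y yr]; last first.
    by case: eqP yr nrx => [->->|].
  by rewrite mupNroot //; move: nrx; rewrite -(roots_on_rootsR p0).
rewrite (bigD1_seq x) ?uniq_roots //= eqxx mul1n big1 ?addn0 // => y.
by move/negPf ->; rewrite mul0n.
Qed.

Lemma sym_spectrum_sums (R : rcfType) (n : nat) (A : 'M[R]_n) :
  A^T = A ->
  [/\ size (spectrum A) = n, \sum_(x <- spectrum A) x = \tr A
    & \sum_(x <- spectrum A) x ^+ 2 = frobenius_norm A ^+ 2].
Proof.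
move=> Asym; have [d [pE trE trE2]] := sym_spectral _ _ _ Asym.
have sE : perm_eq (spectrum A) [seq d 0 i | i <- enum 'I_n].
  by apply: perm_spectrum; rewrite pE big_map big_enum.
split.
- by rewrite (perm_size sE) size_map size_enum_ord.
- by rewrite (perm_big _ sE) big_map big_enum.
rewrite (perm_big _ sE) big_map big_enum /= -trE2 /frobenius_norm sqr_sqrtr.
  (* By symmetry, the term [A i j * A j i] of the trace of the square is [A i j ^+ 2]. *)
  apply: eq_bigr => i _; rewrite mxE; apply: eq_bigr => j _.
  by rewrite -{2}Asym mxE expr2.
by apply: sumr_ge0 => i _; apply: sumr_ge0 => j _; exact: sqr_ge0.
Qed.

(** The spectral argument reduced to lists: with first entry [a], last entry [b] and middle square
    sum [q], the bound amounts to [- b <= sqrt (q + b ^+ 2)]. *)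
Lemma spread_sqrt_bound (R : rcfType) (s : seq R) (F2 : R) :
  sorted >=%R s -> \sum_(x <- s) x = 0 -> \sum_(x <- s) x ^+ 2 = F2 ->
  let n := size s in
  let l := fun i => s`_i.-1 in
  let bound := l 1%N + Num.sqrt (F2 - l 1%N ^+ 2) in
  l 1%N - l n <= bound /\
  (l 1%N - l n = bound <->
    (forall i : nat, (2 <= i <= n - 1)%N -> l i = 0) /\ l 1%N = - l n).
Proof.
case: s => [|a s] /=.
  move=> _ _; rewrite big_nil => <-; rewrite expr0n !subr0 sqrtr0 addr0 oppr0.
  by split=> //; split=> // _; split=> // i; case: i => [|[|]].
(* In a singleton the first and last entries coincide, and the zero sum makes this entry 0. *)
case/lastP: s => [_|s b].
  rewrite !big_seq1 /= => -> <-; rewrite expr0n !subr0 sqrtr0 addr0 oppr0.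
  by split=> //; split=> // _; split=> // i; case: i => [|[|]].
rewrite (path_sortedE (rev_trans le_trans)) all_rcons => /andP[/andP[/= ab _] _].
rewrite !big_cons !big_rcons /= size_rcons /= nth_rcons ltnn eqxx.
set m := \sum_(i <- s) i; set q := \sum_(i <- s) _ => sum0 <-.
have q_ge0 : 0 <= q by apply: sumr_ge0 => x _; exact: sqr_ge0.
have -> : a ^+ 2 + (q + b ^+ 2) - a ^+ 2 = q + b ^+ 2.
  by rewrite addrC addKr.
have bq : Num.sqrt (b ^+ 2) <= Num.sqrt (q + b ^+ 2).
  by rewrite ler_wsqrtr // lerDr.
split.
  by rewrite lerD2l (le_trans _ bq) // sqrtr_sqr -normrN ler_norm.
split=> [/addrI bE|[mid ab0]]; last first.
  (* Here [b <= a] and [a = - b] give [b <= 0], so the root of [b ^+ 2] is [- b]. *)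
  suff q0 : q = 0 by rewrite q0 add0r sqrtr_sqr ler0_norm //; lra.
  rewrite /q big_seq big1 // => x xs.
  (* The shift by 2 accounts for the leading [a] and for counting from 1. *)
  have := mid (index x s).+2; rewrite /= nth_rcons index_mem xs nth_index //.
  by rewrite subSS subn0 ltnS index_mem xs => ->; rewrite ?expr0n.
have q0 : q = 0.
  (* Squaring [- b = sqrt (q + b ^+ 2)] leaves [q = 0]; a vanishing sum of squares then kills every
     middle entry. *)
  have := congr1 (fun x => x ^+ 2) bE.
  rewrite sqrrN sqr_sqrtr ?addr_ge0 ?sqr_ge0 //; lra.
have s0 x : x \in s -> x = 0.
  move=> xs; apply/eqP; rewrite -sqrf_eq0; move/eqP: q0.
  by rewrite psumr_eq0 => [/allP/(_ x xs) //|y _]; exact: sqr_ge0.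
split=> [[|[|i]] //|].
  rewrite subSS subn0 !ltnS => /= lt_is.
  by rewrite nth_rcons lt_is; exact/s0/mem_nth.
have m0 : m = 0 by rewrite /m big_seq big1.
by move: sum0; rewrite m0; lra.
Qed.

Lemma lanzhou_mx_sym (R : rcfType) (V : finType) (e : rel V) :
  symmetric e -> (lanzhou_mx R e)^T = lanzhou_mx R e.
Proof. by move=> e_sym; apply/matrixP => i j; rewrite !mxE e_sym addnC. Qed.

Lemma lanzhou_mx_trace (R : rcfType) (V : finType) (e : rel V) :
  irreflexive e -> \tr (lanzhou_mx R e) = 0.
Proof. by move=> e_irr; apply: big1 => i _; rewrite mxE e_irr. Qed.

Theorem theorem25 (R : rcfType) (V : finType) (e : rel V)
    (e_sym : symmetric e) (e_irr : irreflexive e) :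
  let n := #|V| in
  let A := lanzhou_mx R e in
  let lambda := eigval A in
  let bound := lambda 1%N + Num.sqrt (frobenius_norm A ^+ 2 - lambda 1%N ^+ 2) in
  spread A <= bound /\
  (spread A = bound <->
    (forall i : nat, (2 <= i <= n - 1)%N -> lambda i = 0) /\
    lambda 1%N = - lambda n).
Proof.
move=> n A lambda bound.
have [sz s1 s2] := sym_spectrum_sums _ _ _ (lanzhou_mx_sym R _ _ e_sym).
rewrite lanzhou_mx_trace // in s1.
have srt : sorted >=%R (spectrum A) by apply: sort_sorted => x y; exact: le_total.
have := spread_sqrt_bound _ _ _ srt s1 s2.
by rewrite /= sz.
Qed.
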